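(* There is an absolute constant $c$ such that, in the modified adaptive FMM algorithm with $N$ particles in $[0,1]^3$, the number of M2M operations and the number of L2L operations are each at most $cN$; that is, the number of M2M and L2L operations is $\mathcal{O}(N)$.
   Context: **Adaptive octree.** Given particles $x_1,\dots,x_N\in[0,1]^3$, $N\ge1$, and an integer threshold $t\ge1$, the root corresponds to the cube $[0,1]^3$. A node containing more than $t$ particles is subdivided into its $8$ congruent sub-cubes; only children containing particles are kept. A node with at most $t$ particles is a leaf. A particle on a dividing midplane is assigned to the left (lower-coordinate) child, so each particle in a node belongs to exactly one child. The tree is assumed finite (automatic if the particles are distinct). **Extended octree.** Let $l_{\max}$ be the depth of the adaptive octree. The extended octree is obtained by adding, for every non-leaf node, all its missing (empty) children, and then repeatedly subdividing every leaf (occupied or empty) of depth less than $l_{\max}$ into $8$ children until all leaves are at depth $l_{\max}$. A node is occupied if it contains at least one particle and empty otherwise. The statement refers to either of these two trees. **Divided and singleton nodes.** A divided node is an occupied node with at least two occupied children. A singleton node is an occupied node with exactly one occupied child. Leaves and empty nodes are neither. The divided parent of a non-root node is its deepest proper ancestor that is a divided node or the root. The divided children of a divided node $\nu$ are the occupied proper descendants $\beta$ of $\nu$ that are divided nodes or leaves and such that no node strictly between $\nu$ and $\beta$ is divided. **Modified adaptive FMM.** Multipole and local coefficients are not considered for singleton nodes. M2M passes the multipole coefficients of an occupied non-singleton node directly to its divided parent: one M2M operation for each pair (non-root occupied non-singleton node, its divided parent). L2L passes the local coefficients of a divided node directly to its divided children: one L2L operation for each pair (divided node, one of its divided children). *)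

(* Defs.v *)
From mathcomp Require Import all_boot all_order all_algebra finmap.
From mathcomp Require Import all_classical all_reals.

Set Implicit Arguments.
Unset Strict Implicit.
Unset Printing Implicit Defensive.

Import Order.TTheory GRing.Theory Num.Theory.
Local Open Scope classical_set_scope.
Local Open Scope ring_scope.

(* Component [k] is [true] for the upper half of the cube in direction [k]. *)
Definition octant := {ffun 'I_3 -> bool}.

(* A dyadic sub-cube of [0,1]^3 is encoded by the successive octants leading to
   it, the deepest one first: the root is [::], the children of [v] are the
   [o :: v], the depth is [size v] and the ancestors are the suffixes. *)
Definition node := seq octant.

Definition child (v : node) (o : octant) : node := o :: v.

Definition depth (v : node) : nat := size v.

Definition proper_ancestor (u v : node) : bool := suffix u v && (u != v).

Definition side (R : realType) (v : node) : R := 2^-1 ^+ depth v.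

Fixpoint corner (R : realType) (v : node) (k : 'I_3) : R :=
  if v is o :: u then corner R u k + (o k)%:R * side R v else 0.

Definition midpoint (R : realType) (v : node) (k : 'I_3) : R :=
  corner R v k + side R v / 2.

(* The strict inequality sends a particle on a midplane to the lower child. *)
Fixpoint particles (R : realType) (N : nat) (x : 'I_N -> 'rV[R]_3) (v : node)
    : {set 'I_N} :=
  if v is o :: u
  then [set i in particles x u |
          [forall k, o k == (midpoint R u k < x i 0 k)]]%SET
  else [set: 'I_N]%SET.

Definition occupied (R : realType) (N : nat) (x : 'I_N -> 'rV[R]_3) (v : node)
    : bool :=
  (0 < #|particles x v|)%N.

Inductive adaptive_node (R : realType) (N : nat) (x : 'I_N -> 'rV[R]_3)
    (t : nat) : node -> Prop :=
| adaptive_root : adaptive_node x t [::]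
| adaptive_child (v : node) (o : octant) :
    adaptive_node x t v -> (t < #|particles x v|)%N ->
    occupied x (child v o) -> adaptive_node x t (child v o).

Definition adaptive_octree (R : realType) (N : nat) (x : 'I_N -> 'rV[R]_3)
    (t : nat) : set node :=
  [set v | adaptive_node x t v].

Definition leaf (T : set node) (v : node) : Prop :=
  T v /\ forall o, ~ T (child v o).

(* Meaningful for finite [T] only: [fset_set] of an infinite set is empty. *)
Definition tree_depth (T : set node) : nat := \max_(v <- fset_set T) depth v.

Definition add_missing_children (T : set node) : set node :=
  T `|` [set w | exists v o, [/\ T v, ~ leaf T v & w = child v o]].

Definition subdivide_leaves (l : nat) (T : set node) : set node :=
  T `|` [set w | exists v o, [/\ leaf T v, (depth v < l)%N & w = child v o]].

Definition extended_octree (R : realType) (N : nat) (x : 'I_N -> 'rV[R]_3)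
    (t : nat) : set node :=
  let A := adaptive_octree x t in
  \bigcup_(n in [set: nat])
    iter n (subdivide_leaves (tree_depth A)) (add_missing_children A).

Definition occupied_child (R : realType) (N : nat) (x : 'I_N -> 'rV[R]_3)
    (T : set node) (v : node) (o : octant) : Prop :=
  T (child v o) /\ occupied x (child v o).

Definition divided_node (R : realType) (N : nat) (x : 'I_N -> 'rV[R]_3)
    (T : set node) (v : node) : Prop :=
  [/\ T v, occupied x v & exists o1 o2,
      [/\ o1 <> o2, occupied_child x T v o1 & occupied_child x T v o2]].

Definition singleton_node (R : realType) (N : nat) (x : 'I_N -> 'rV[R]_3)
    (T : set node) (v : node) : Prop :=
  [/\ T v, occupied x v & exists! o, occupied_child x T v o].

Definition divided_or_root (R : realType) (N : nat) (x : 'I_N -> 'rV[R]_3)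
    (T : set node) (v : node) : Prop :=
  divided_node x T v \/ v = [::].

Definition divided_parent (R : realType) (N : nat) (x : 'I_N -> 'rV[R]_3)
    (T : set node) (v u : node) : Prop :=
  [/\ proper_ancestor u v, divided_or_root x T u
    & forall w, proper_ancestor w v -> divided_or_root x T w ->
        (depth w <= depth u)%N].

Definition divided_child (R : realType) (N : nat) (x : 'I_N -> 'rV[R]_3)
    (T : set node) (v b : node) : Prop :=
  [/\ T b /\ occupied x b, proper_ancestor v b, divided_node x T b \/ leaf T b
    & forall w, proper_ancestor v w -> proper_ancestor w b -> ~ divided_node x T w].

Definition m2m_operations (R : realType) (N : nat) (x : 'I_N -> 'rV[R]_3)
    (T : set node) : set (node * node) :=
  [set p | [/\ T p.1, p.1 <> [::], occupied x p.1, ~ singleton_node x T p.1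
             & divided_parent x T p.1 p.2]].

Definition l2l_operations (R : realType) (N : nat) (x : 'I_N -> 'rV[R]_3)
    (T : set node) : set (node * node) :=
  [set p | divided_node x T p.1 /\ divided_child x T p.1 p.2].

(* Main.v *)
Require Import Defs.
From mathcomp Require Import all_boot all_order all_algebra.
From mathcomp Require Import all_classical all_reals.
From mathcomp Require Import zify.

(* An operation of either kind is determined by its lower node, which is divided
   or has no occupied child, so at most 2N such nodes have to be found.  Each
   particle lies in at most one node without occupied child.  A divided node [v]
   is charged to a particle having the least index in some child of [v] but not
   in [v].  The nodes containing a particle [i] form a chain, and [i] has the
   least index exactly from some point of the chain downwards, so that [i] is
   charged at most once. *)

Set Implicit Arguments.
Unset Strict Implicit.
Unset Printing Implicit Defensive.

Import Order.TTheory GRing.Theory Num.Theory.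
Local Open Scope classical_set_scope.
Local Open Scope card_scope.
Local Open Scope ring_scope.

(** * Counting by charges, and trees closed under ancestors *)

Lemma card_le_charge (U : Type) (A : set U) (m : nat)
    (charge : U -> nat -> Prop) :
  (forall a, A a -> exists2 k, (k < m)%N & charge a k) ->
  (forall a b k, A a -> A b -> charge a k -> charge b k -> a = b) ->
  A #<= `I_m.
Proof.
move=> chargeT charge_inj.
have /choice [f fP] a : exists k, A a -> (k < m)%N /\ charge a k.
  have [/chargeT [k km ck]|nAa] := pselect (A a); first by exists k.
  (* Default value off [A]; injectivity is only asked on [A]. *)
  by exists 0%N.
have f_inj : {in A &, injective f}.
  move=> a b /set_mem Aa /set_mem Ab eq_f.
  have [_ ca] := fP a Aa; have [_ cb] := fP b Ab.
  by rewrite eq_f in ca; apply: charge_inj ca cb.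
rewrite -(card_le_eql (inj_card_eq f_inj)); apply: subset_card_le.
by move=> _ [a /fP [? _] <-].
Qed.

(** The property shared by the adaptive and the extended octree on which the counting rests, so that
    one argument serves both. *)
Definition ancestor_closed (T : set node) :=
  forall u v, suffix u v -> T v -> T u.

Lemma parent_closed (T : set node) :
  (forall v o, T (child v o) -> T v) -> ancestor_closed T.
Proof.
move=> Tpar u v /suffixP [s ->] {v}.
by elim: s => [//|o s IHs] /= /Tpar.
Qed.

Lemma adaptive_octree_closed (R : realType) (N t : nat) (x : 'I_N -> 'rV[R]_3) :
  ancestor_closed (adaptive_octree x t).
Proof.
by apply: parent_closed => v o Tvo; inversion Tvo.
Qed.

(** Induction on the number of subdivision rounds: a node added in a round is a child of a leaf of
    the previous tree, so its parent is already present. *)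
Lemma extended_octree_closed (R : realType) (N t : nat) (x : 'I_N -> 'rV[R]_3) :
  ancestor_closed (extended_octree x t).
Proof.
apply: parent_closed => v o [n _ Tc]; exists n => //; move: Tc.
elim: n v o => [|n IHn] v o /=.
- case=> [Tc|[u [o' [Tu _ [_ ->]]]]]; last by left.
  by left; apply: adaptive_octree_closed Tc; apply: (suffix_suffix [:: o]).
- by case=> [/IHn Tv|[u [o' [[Tu _] _ [_ ->]]]]]; left.
Qed.

Lemma suffix_size_inj (u u' v : node) :
  suffix u v -> suffix u' v -> size u = size u' -> u = u'.
Proof. by rewrite !suffixE => /eqP Eu /eqP Eu' eq_size; rewrite -Eu -Eu' eq_size. Qed.

Lemma suffix_total (u u' v : node) :
  suffix u v -> suffix u' v -> (size u <= size u')%N -> suffix u u'.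
Proof.
rewrite !suffixE => /eqP Eu /eqP Eu' le_uu'; apply/eqP.
have le_u'v : (size u' <= size v)%N by rewrite -Eu' size_drop leq_subr.
by rewrite -[X in drop _ X]Eu' drop_drop addnC addnBA // subnK // Eu.
Qed.

Lemma proper_ancestor_child (u v : node) :
  proper_ancestor u v -> exists o, suffix (child u o) v.
Proof.
case/andP=> /suffixP [s ->]; case: (lastP s) => [|s' o _]; first by rewrite eqxx.
by exists o; rewrite cat_rcons suffix_suffix.
Qed.

(** * Nodes containing a given particle *)

Section Octree.
Variables (R : realType) (N : nat) (x : 'I_N -> 'rV[R]_3).

Lemma particles_suffix (u v : node) :
  suffix u v -> particles x v \subset particles x u.
Proof.
case/suffixP=> s ->{v}; elim: s => [//|o s IHs] /=.
by apply: fintype.subset_trans IHs; apply/fintype.subsetP => i; rewrite inE => /andP[].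
Qed.

(** Going down from the root, comparing the particle with the midpoint dictates the octant at every
    level. *)
Lemma particles_size_inj (i : 'I_N) (u v : node) : size u = size v ->
  i \in particles x u -> i \in particles x v -> u = v.
Proof.
elim: u v => [|o u IHu] [|o' v] //= [/IHu eq_uv].
rewrite !inE => /andP[iu /forallP ou] /andP[iv /forallP ov].
have E := eq_uv iu iv; rewrite -{v eq_uv iv}E in ov *; congr cons.
by apply/ffunP => k; rewrite (eqP (ou k)) (eqP (ov k)).
Qed.

(** The ancestor of [v] at the depth of [u] also contains [i], and only one node of that depth
    does. *)
Lemma particles_chain (i : 'I_N) (u v : node) : (size u <= size v)%N ->
  i \in particles x u -> i \in particles x v -> suffix u v.
Proof.
move=> le_uv iu iv; set w := drop (size v - size u) v.
have wv : suffix w v := suffix_drop v (size v - size u).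
suff -> : u = w by [].
apply: (particles_size_inj (i := i)) => //; first by rewrite size_drop subKn.
exact: (fintype.subsetP (particles_suffix wv)).
Qed.

Lemma occupied_mem (i : 'I_N) (v : node) : i \in particles x v -> occupied x v.
Proof. by move=> iv; apply/card_gt0P; exists i. Qed.

Definition least_particle (v : node) (i : 'I_N) :=
  i \in particles x v /\ forall j, j \in particles x v -> (i <= j)%N.

Lemma least_particle_exists (v : node) :
  occupied x v -> exists i, least_particle v i.
Proof.
case/card_gt0P=> i0 i0v; case: (arg_minnP (@nat_of_ord N) i0v) => i iv le_i.
by exists i; split.
Qed.

(** * Charging nodes to particles *)

Variable T : set node.
Hypothesis Tclosed : ancestor_closed T.

(** Phrased through occupied children rather than [leaf], so that every occupied non-singleton node
    of [T] is divided or unbranched. *)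
Definition unbranched (v : node) := forall o, ~ occupied_child x T v o.

Definition marked (v : node) :=
  [/\ T v, occupied x v & divided_node x T v \/ unbranched v].

(** The shift by [N] keeps the two kinds of charge apart: each particle offers one charge of each
    kind, whence the bound [2 * N]. *)
Definition charge (v : node) (k : nat) :=
  (exists i : 'I_N, [/\ k = i, i \in particles x v & unbranched v]) \/
  (exists i : 'I_N, [/\ k = (N + i)%N, ~ least_particle v i
     & exists o, least_particle (child v o) i]).

Lemma charge_exists (v : node) : marked v ->
  exists2 k, (k < 2 * N)%N & charge v k.
Proof.
case=> Tv /card_gt0P [i iv] [[_ _ [o1 [o2 [o12 [_ oc1] [_ oc2]]]]]|uv]; last first.
  by exists i; [have := ltn_ord i; lia|left; exists i].
have [i1 m1] := least_particle_exists oc1.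
have [i2 m2] := least_particle_exists oc2.
(* The two least particles differ, since no particle lies in two children. The larger one is
   charged: the smaller one also lies in [v], so the larger is not least there. *)
wlog lt12 : o1 o2 i1 i2 o12 m1 m2 {oc1 oc2} / (i1 < i2)%N => [wl|].
  have [lt12|lt21|/val_inj eq12] := ltngtP i1 i2.
  - exact: (wl o1 o2 i1 i2).
  - by apply: (wl o2 o1 i2 i1) => // /esym.
  - have [E] : child v o1 = child v o2; last by case: o12.
    by apply: (particles_size_inj (i := i1)); [|apply m1|rewrite eq12; apply m2].
exists (N + i2)%N; first by have := ltn_ord i2; lia.
right; exists i2; split=> //; last by exists o2.
case=> _ /(_ i1) le21; suff: (i2 <= i1)%N by lia.
apply: le21; apply: fintype.subsetP (proj1 m1).
exact/particles_suffix/(suffix_suffix [:: o1]).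
Qed.

Lemma least_particle_sub (u v : node) (i : 'I_N) :
  suffix u v -> least_particle u i -> i \in particles x v -> least_particle v i.
Proof.
by move=> uv [_ le_i] iv; split=> // j /(fintype.subsetP (particles_suffix uv)) /le_i.
Qed.

Lemma charge_inj (u v : node) (k : nat) : marked u -> marked v ->
  charge u k -> charge v k -> u = v.
Proof.
wlog le_uv : u v / (size u <= size v)%N => [wl mu mv cu cv|].
  have [/wl|/ltnW /wl wl'] := leqP (size u) (size v); first exact.
  by apply/esym; apply: wl'.
move=> _ [Tv _ _].
have down i : i \in particles x u -> i \in particles x v -> u <> v ->
    exists o, suffix (child u o) v.
  move=> iu iv /eqP uv; apply: proper_ancestor_child.
  by rewrite /proper_ancestor uv (particles_chain le_uv iu iv).
have childW w o (i : 'I_N) : i \in particles x (child w o) -> i \in particles x w.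
  by apply/fintype.subsetP/particles_suffix/(suffix_suffix [:: o]).
case=> [[i [-> iu unbu]]|[i [-> nlu [o lou]]]].
- case=> [[j [/val_inj <- iv _]]|[j [eq_k _ _]]]; last by have := ltn_ord i; lia.
  (* Otherwise the child of [u] towards [v] is in [T] by closure and contains [i]. *)
  apply: contrapT => /(down i iu iv) [o uov]; apply: (unbu o); split.
    exact: Tclosed Tv.
  exact: occupied_mem (fintype.subsetP (particles_suffix uov) _ iv).
- case=> [[j [eq_k _ _]]|[j [/addnI/val_inj <- nlv [o' [iv' _]]]]].
    by have := ltn_ord j; lia.
  have iu : i \in particles x u by apply: childW (proj1 lou).
  have iv := childW _ _ _ iv'.
  (* The child of [u] towards [v] contains [i], hence is the child where [i] is least; leastness
     then passes down to [v]. *)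
  apply: contrapT => /(down i iu iv) [o2 uov]; apply: nlv.
  have Eo : child u o2 = child u o.
    apply: (particles_size_inj (i := i)) => //; last by apply lou.
    exact: (fintype.subsetP (particles_suffix uov)).
  by rewrite Eo in uov; apply: least_particle_sub uov lou iv.
Qed.

(** [low] selects the deeper node of an operation: the source for M2M, the target for L2L. *)
Lemma card_operations (A : set (node * node)) (low : node * node -> node) :
  (forall p, A p -> marked (low p)) ->
  (forall p q, A p -> A q -> low p = low q -> p = q) ->
  A #<= `I_(2 * N).
Proof.
move=> Am Ainj; apply: (card_le_charge (charge := fun p => charge (low p))).
  by move=> p /Am /charge_exists.
by move=> p q k Ap Aq cp cq; apply: Ainj => //; apply: charge_inj cp cq; apply: Am.
Qed.

(** * Operations are determined by their lower node *)

Lemma nonsingleton_marked (v : node) :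
  T v -> occupied x v -> ~ singleton_node x T v -> marked v.
Proof.
move=> Tv ov nsv; split=> //.
have [[o oc]|no] := pselect (exists o, occupied_child x T v o); last first.
  by right=> o oc; apply: no; exists o.
left; split=> //; apply: contrapT => no2; apply: nsv; split=> //.
by exists o; split=> // o' oc'; apply: contrapT => oo'; apply: no2; exists o, o'.
Qed.

Lemma divided_parent_uniq (u u' v : node) :
  divided_parent x T v u -> divided_parent x T v u' -> u = u'.
Proof.
case=> uv du maxu [u'v du' maxu'].
have /andP[suv _] := uv; have /andP[su'v _] := u'v.
apply: suffix_size_inj suv su'v _; apply/eqP.
by rewrite eqn_leq; apply/andP; split; [apply: maxu'|apply: maxu].
Qed.

(** Both nodes are ancestors of [b]; if they differed, the deeper one would be a divided node
    strictly between the other and [b]. *)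
Lemma divided_child_uniq (u u' b : node) :
  divided_node x T u -> divided_node x T u' ->
  divided_child x T u b -> divided_child x T u' b -> u = u'.
Proof.
move=> du du' [_ ub _ nou] [_ u'b _ nou'].
wlog le_uu' : u u' du du' ub u'b nou nou' / (size u <= size u')%N => [wl|].
  have [le|/ltnW le] := leqP (size u) (size u'); first exact: wl.
  by apply/esym; apply: wl.
apply: contrapT => /eqP neq; apply: (nou u') => //.
have /andP[sub _] := ub; have /andP[su'b _] := u'b.
by rewrite /proper_ancestor neq (suffix_total sub su'b le_uu').
Qed.

Lemma card_m2m : m2m_operations x T #<= `I_(2 * N).
Proof.
apply: (card_operations (low := fst)).
  by move=> p [Tp _ op np _]; apply: nonsingleton_marked.
move=> [v u] [v' u'] [_ _ _ _ /= dp] [_ _ _ _ /= dp'] /= E.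
by rewrite -E in dp' *; rewrite (divided_parent_uniq dp dp').
Qed.

Lemma card_l2l : l2l_operations x T #<= `I_(2 * N).
Proof.
apply: (card_operations (low := snd)).
  move=> p [_ [[Tb ob] _ db _]]; split=> //.
  by case: db => [|[_ lf]]; [left|right=> o [/lf]].
move=> [v b] [v' b'] [/= dv dc] [/= dv' dc'] /= E.
by rewrite -E in dc' *; rewrite (divided_child_uniq dv dv' dc dc').
Qed.

End Octree.

Theorem lemma6 :
  exists c : nat,
  forall (R : realType) (N t : nat) (x : 'I_N -> 'rV[R]_3) (T : set node),
    (1 <= N)%N -> (1 <= t)%N ->
    (forall i k, 0 <= x i 0 k <= 1) ->
    finite_set (adaptive_octree x t) ->
    T = adaptive_octree x t \/ T = extended_octree x t ->
    m2m_operations x T #<= `I_(c * N) /\ l2l_operations x T #<= `I_(c * N).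
Proof.
exists 2%N => R N t x T _ _ _ _ defT.
have Tclosed : ancestor_closed T.
  by case: defT => ->; [apply: adaptive_octree_closed|apply: extended_octree_closed].
by split; [apply: card_m2m|apply: card_l2l].
Qed.
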